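(* Let $G$ be a finite simple connected graph with at least one edge, with maximum degree $\Delta$ and minimum degree $\delta$, and let $\alpha\in\mathbb{R}\setminus\{0\}$. Then the following statements hold. (a) If $\alpha\le -1/2$, then $\delta^{-2\alpha}R_\alpha(G)\le GA_1(G)\le \Delta^{-2\alpha}R_\alpha(G)$. (b) If $\alpha\ge -1/2$, then $\delta\,\Delta^{-2\alpha-1}R_\alpha(G)\le GA_1(G)\le \Delta\,\delta^{-2\alpha-1}R_\alpha(G)$. Furthermore, each of these equalities holds if and only if $G$ is a regular graph.
   Context: For a graph $G$ with vertex set $V(G)$ and edge set $E(G)$, $d_u$ denotes the degree of the vertex $u$. The first geometric-arithmetic index is $GA_1(G)=\sum_{uv\in E(G)}\frac{2\sqrt{d_ud_v}}{d_u+d_v}$. For $\alpha\in\mathbb{R}\setminus\{0\}$ the general Randić index is $R_\alpha(G)=\sum_{uv\in E(G)}(d_ud_v)^\alpha$. *)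

(* Defs.v *)
From HB Require Import structures.
From mathcomp Require Import all_boot all_order all_algebra.
From mathcomp Require Import all_classical all_reals all_analysis.
Set Implicit Arguments.
Unset Strict Implicit.
Unset Printing Implicit Defensive.
Import Order.TTheory GRing.Theory Num.Theory.
Local Open Scope ring_scope.

Record sgraph := SGraph {
  vertex :> finType;
  adj : rel vertex;
  adj_sym : symmetric adj;
  adj_irrefl : irreflexive adj
}.

Definition edges (G : sgraph) : {set {set G}} :=
  [set [set p.1; p.2] | p in [pred p : G * G | adj p.1 p.2]].

Definition deg (G : sgraph) (u : G) : nat := #|[set v : G | adj u v]|.

Definition max_degree (G : sgraph) : nat := \max_(u : G) deg u.

(* #|G| bounds every degree, so the default value of the minimum only matters
   for the graph without vertices. *)
Definition min_degree (G : sgraph) : nat := \big[minn/#|G|]_(u : G) deg u.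

Definition connected_graph (G : sgraph) : Prop :=
  forall u v : G, connect (@adj G) u v.

Definition regular_graph (G : sgraph) : Prop :=
  exists k : nat, forall u : G, deg u = k.

(* An edge uv is the two-element set A = [set u; v], so that the products and
   sums over A below are d_u * d_v and d_u + d_v. *)
Definition GA1 (R : realType) (G : sgraph) : R :=
  \sum_(A in edges G)
     (2 * Num.sqrt (\prod_(u in A) (deg u)%:R) / \sum_(u in A) (deg u)%:R).

Definition randic (R : realType) (alpha : R) (G : sgraph) : R :=
  \sum_(A in edges G) (\prod_(u in A) (deg u)%:R) `^ alpha.

(* Main.v *)
Require Import Defs.
From HB Require Import structures.
From mathcomp Require Import all_boot all_order all_algebra.
From mathcomp Require Import all_classical all_reals all_analysis.
From mathcomp Require Import ring lra.
Set Implicit Arguments.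
Unset Strict Implicit.
Unset Printing Implicit Defensive.
Import Order.TTheory GRing.Theory Num.Theory.
Local Open Scope ring_scope.

(* For an edge uv put x = d_u, y = d_v and p = -1/2 - alpha.  Then
     2 sqrt(xy) / (x+y) = (2xy / (x+y)) (xy)^p (xy)^alpha.
   The harmonic mean 2xy/(x+y) lies between delta and Delta and reaches either
   bound only when x and y both do, while (xy)^p lies between delta^(2p) and
   Delta^(2p), in the order given by the sign of p.  Summing over the edges
   gives all the bounds; equality forces every vertex of an edge, hence every
   vertex, to have degree delta (resp. Delta).  Conversely, in a regular graph
   delta = Delta, so the lower and upper bounds coincide. *)

(** * Degrees in a connected graph with an edge *)

Section Degrees.
Variable G : sgraph.

Lemma min_degree_le (u : G) : (min_degree G <= deg u)%N.
Proof. by rewrite /min_degree -minEnat -leEnat; exact: bigmin_le_cond. Qed.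

Lemma max_degree_ge (u : G) : (deg u <= max_degree G)%N.
Proof. exact: leq_bigmax. Qed.

Lemma edgesP (A : {set G}) :
  reflect (exists u v, adj u v /\ A = [set u; v]%SET) (A \in edges G).
Proof.
apply: (iffP imsetP) => [[[u v] /= uv ->]|[u [v [uv ->]]]]; first by exists u, v.
by exists (u, v).
Qed.

Lemma adj_neq (u v : G) : adj u v -> u != v.
Proof. by apply: contraTneq => ->; rewrite adj_irrefl. Qed.

Hypothesis hconn : connected_graph G.
Hypothesis hedge : edges G != finset.set0.

(** A path from [u] to an endpoint of some edge starts with a neighbor of [u]; if [u] is that
    endpoint, the edge itself supplies one. *)
Lemma connected_neighbor (u : G) : exists v, adj u v.
Proof.
have [A /edgesP[a [b [ab _]]]] := set0Pn _ hedge.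
have [->|ua] := eqVneq u a; first by exists b.
have /connectP[[|w p] /= uwp aE] := hconn u a; first by rewrite aE eqxx in ua.
by exists w; case/andP: uwp.
Qed.

Lemma connected_deg_gt0 (u : G) : (0 < deg u)%N.
Proof.
have [v uv] := connected_neighbor u.
by apply/card_gt0P; exists v; rewrite inE.
Qed.

Lemma connected_min_degree_gt0 : (0 < min_degree G)%N.
Proof.
have [A /edgesP[a _]] := set0Pn _ hedge.
rewrite /min_degree; elim/big_ind: _ => [|m n m0 n0|u _]; last exact: connected_deg_gt0.
(* The default value [#|G|] of the minimum is positive too, since [a] is a vertex. *)
- by apply/card_gt0P; exists a.
- by rewrite leq_min m0.
Qed.

Lemma regular_min_max : regular_graph G -> min_degree G = max_degree G.
Proof.
have [A /edgesP[a _]] := set0Pn _ hedge.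
move=> [k degk]; apply/eqP; rewrite eqn_leq.
rewrite (leq_trans (min_degree_le a) (max_degree_ge a)) /=.
apply: (@leq_trans k); first by apply/bigmax_leqP => u _; rewrite degk.
rewrite /min_degree; elim/big_ind: _ => [|m n km kn|u _]; last by rewrite degk.
(* The default value [#|G|] is at least [k], because it bounds the degree of [a]. *)
- by rewrite -(degk a) max_card.
- by rewrite leq_min km.
Qed.

Lemma connected_regular (k : nat) :
  (forall u v : G, adj u v -> deg u = k) -> regular_graph G.
Proof. by move=> h; exists k => u; have [v /h] := connected_neighbor u. Qed.

End Degrees.

(** * Harmonic mean bounds and their equality cases *)

Section RealFieldBounds.
Variable R : realFieldType.
Implicit Types a b x y : R.

(** 2xy - a(x + y) = x(y - a) + y(x - a) is a sum of nonnegative terms. *)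
Lemma harmonic_mean_ge a x y : 0 < a -> a <= x -> a <= y ->
  a <= 2 * (x * y) / (x + y).
Proof. by move=> a0 ax ay; rewrite ler_pdivlMr; [nra|lra]. Qed.

Lemma harmonic_mean_le a x y : 0 < x -> 0 < y -> x <= a -> y <= a ->
  2 * (x * y) / (x + y) <= a.
Proof. by move=> x0 y0 xa ya; rewrite ler_pdivrMr; [nra|lra]. Qed.

(** Equality makes both terms x(y - a) and y(x - a) vanish, and y > 0. *)
Lemma harmonic_mean_eq_min a x y : 0 < a -> a <= x -> a <= y ->
  2 * (x * y) / (x + y) = a -> x = a.
Proof.
move=> a0 ax ay /eqP; rewrite -[X in _ == X]divr1 eqr_div ?oner_eq0//; last lra.
by move=> /eqP; nra.
Qed.

Lemma harmonic_mean_eq_max a x y : 0 < x -> 0 < y -> x <= a -> y <= a ->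
  2 * (x * y) / (x + y) = a -> x = a.
Proof.
move=> x0 y0 xa ya /eqP; rewrite -[X in _ == X]divr1 eqr_div ?oner_eq0//; last lra.
by move=> /eqP; nra.
Qed.

(** If a < x, then ab < xb <= xy. This separates the harmonic mean from the power of the degree
    product in the equality case. *)
Lemma eq_factor_lower a b x y :
  0 < a -> 0 < b -> a <= x -> b <= y -> a * b = x * y -> x = a.
Proof.
move=> a0 b0 ax ley E; apply/le_anti; rewrite ax andbT leNgt; apply/negP => xa.
suff : a * b < x * y by rewrite E ltxx.
by rewrite (@lt_le_trans _ _ (x * b)) ?ltr_pM2r// ler_pM2l// (lt_trans a0).
Qed.

Lemma eq_factor_upper a b x y :
  0 < x -> 0 < y -> x <= a -> y <= b -> x * y = a * b -> x = a.
Proof.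
move=> x0 y0 xa yb E; exact/esym/(eq_factor_lower x0 y0 xa yb E).
Qed.

End RealFieldBounds.

(** * Real powers and the factorization of an edge term *)

Section PowR.
Variable R : realType.
Implicit Types a b x y p alpha : R.

Lemma powR_mulrr a p : 0 < a -> (a * a) `^ p = a `^ (2 * p).
Proof.
by move=> a0; rewrite powRM ?ltW// -powRD ?(gt_eqF a0) ?implybT// -mulr2n mulr_natl.
Qed.

Lemma powRSr a p : 0 < a -> a `^ p = a * a `^ (p - 1).
Proof.
move=> a0; rewrite -[X in X * _]powRr1 ?ltW// -powRD ?(gt_eqF a0) ?implybT//.
by congr (_ `^ _); ring.
Qed.

Lemma powR_le_nneg a b p : 0 <= p -> 0 <= a -> a <= b -> a `^ p <= b `^ p.
Proof. by move=> p0 a0 ab; rewrite ge0_ler_powR// nnegrE// (le_trans a0). Qed.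

Lemma powR_le_npos a b p : p <= 0 -> 0 < a -> a <= b -> b `^ p <= a `^ p.
Proof.
move=> p0 a0 ab; have b0 := lt_le_trans a0 ab.
rewrite -[p]opprK !(powRN _ (- p)) lef_pV2 ?posrE ?powR_gt0//.
by apply: powR_le_nneg => //; [rewrite oppr_ge0|exact: ltW].
Qed.

Lemma GA_term_factor alpha x y : 0 < x -> 0 < y ->
  2 * Num.sqrt (x * y) / (x + y) =
  2 * (x * y) / (x + y) * (x * y) `^ (- (1 / 2) - alpha) * (x * y) `^ alpha.
Proof.
move=> x0 y0; have xy0 : 0 < x * y by rewrite mulr_gt0.
(* The two powers of xy merge into exponent -1/2, so with s = sqrt(xy) both sides are 2s / (x +
   y). *)
rewrite -[RHS]mulrA -powRD ?(gt_eqF xy0) ?implybT// subrK div1r powRN.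
rewrite powR12_sqrt ?ltW//; set s := Num.sqrt _.
have s0 : 0 < s by rewrite sqrtr_gt0.
have -> : x * y = s ^+ 2 by rewrite sqr_sqrtr ?ltW.
by field; rewrite (gt_eqF s0) gt_eqF// addr_gt0.
Qed.

End PowR.

(** * Summation over the edges and the two ranges of [alpha] *)

Section EdgeSums.
Variables (R : realType) (G : sgraph) (alpha : R).
Hypothesis hconn : connected_graph G.
Hypothesis hedge : edges G != finset.set0.

Let dg (u : G) : R := (deg u)%:R.
Let D : R := (max_degree G)%:R.
Let d : R := (min_degree G)%:R.
Let p : R := - (1 / 2) - alpha.

Let d_gt0 : 0 < d. Proof. by rewrite ltr0n connected_min_degree_gt0. Qed.
Let dg_gt0 u : 0 < dg u. Proof. by rewrite ltr0n connected_deg_gt0. Qed.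
Let d_le u : d <= dg u. Proof. by rewrite ler_nat min_degree_le. Qed.
Let D_ge u : dg u <= D. Proof. by rewrite ler_nat max_degree_ge. Qed.

Let H (u v : G) : R := 2 * (dg u * dg v) / (dg u + dg v).

Let GA_edge (A : {set G}) : R :=
  2 * Num.sqrt (\prod_(u in A) (deg u)%:R) / \sum_(u in A) (deg u)%:R.
Let randic_edge (A : {set G}) : R := (\prod_(u in A) (deg u)%:R) `^ alpha.

Let randic_edgeE (u v : G) : adj u v ->
  randic_edge [set u; v] = (dg u * dg v) `^ alpha.
Proof. by move/adj_neq=> uv; rewrite /randic_edge big_setU1 ?inE// big_set1. Qed.

Let GA_edgeE (u v : G) : adj u v ->
  GA_edge [set u; v] = H u v * (dg u * dg v) `^ p * (dg u * dg v) `^ alpha.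
Proof.
move/adj_neq=> uv; rewrite /GA_edge !big_setU1 ?inE// !big_set1 /=.
exact: (GA_term_factor alpha (dg_gt0 u) (dg_gt0 v)).
Qed.

Lemma GA1_lower (c : R) : 0 < c ->
    (forall u v, c <= (dg u * dg v) `^ p) ->
  d * c * randic alpha G <= GA1 R G /\
  (d * c * randic alpha G = GA1 R G -> regular_graph G).
Proof.
move=> c0 hc; rewrite /randic mulr_sumr.
(* Recording each edge inequality as [leif] lets [leif_sum] turn equality of the sums into equality
   on every edge. *)
have le A : A \in edges G ->
    d * c * randic_edge A <= GA_edge A ?= iff (d * c * randic_edge A == GA_edge A).
  move=> /edgesP[u [v [uv ->]]]; apply: leif_eq.
  rewrite GA_edgeE// randic_edgeE// ler_wpM2r ?powR_ge0//.
  by apply: ler_pM; rewrite ?hc ?(ltW c0) ?(ltW d_gt0)//; exact: harmonic_mean_ge.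
have [le_sum eq_sum] := leif_sum le; split=> // /eqP.
rewrite eq_sum => /forall_inP eq_edge.
apply: (@connected_regular _ hconn hedge (min_degree G)) => u v uv.
have /eq_edge/eqP : [set u; v]%SET \in edges G by apply/edgesP; exists u, v.
rewrite GA_edgeE// randic_edgeE//.
(* Cancelling the positive factor (xy)^alpha leaves d * c = H * (xy)^p, whose factors can then be
   compared separately. *)
move=> /(mulIf (lt0r_neq0 (powR_gt0 _ (mulr_gt0 (dg_gt0 u) (dg_gt0 v))))) eqHw.
have Hd : d <= H u v by exact: harmonic_mean_ge.
move: (eq_factor_lower d_gt0 c0 Hd (hc u v) eqHw).
move=> /(harmonic_mean_eq_min d_gt0 (d_le u) (d_le v))/eqP.
by rewrite eqr_nat => /eqP.
Qed.

Lemma GA1_upper (c : R) : (forall u v, (dg u * dg v) `^ p <= c) ->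
  GA1 R G <= D * c * randic alpha G /\
  (GA1 R G = D * c * randic alpha G -> regular_graph G).
Proof.
move=> hc; rewrite /randic mulr_sumr.
have le A : A \in edges G ->
    GA_edge A <= D * c * randic_edge A ?= iff (GA_edge A == D * c * randic_edge A).
  move=> /edgesP[u [v [uv ->]]]; apply: leif_eq.
  rewrite GA_edgeE// randic_edgeE// ler_wpM2r ?powR_ge0//.
  have Hd : d <= H u v by exact: harmonic_mean_ge.
  apply: ler_pM; rewrite ?hc ?powR_ge0 ?(le_trans (ltW d_gt0))//.
  exact: harmonic_mean_le.
have [le_sum eq_sum] := leif_sum le; split=> // /eqP.
rewrite eq_sum => /forall_inP eq_edge.
apply: (@connected_regular _ hconn hedge (max_degree G)) => u v uv.
have /eq_edge/eqP : [set u; v]%SET \in edges G by apply/edgesP; exists u, v.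
have w0 q : 0 < (dg u * dg v) `^ q by rewrite powR_gt0 ?mulr_gt0.
rewrite GA_edgeE// randic_edgeE// => /(mulIf (lt0r_neq0 (w0 _))) eqHw.
have HD : H u v <= D by exact: harmonic_mean_le.
have H0 : 0 < H u v by apply: lt_le_trans d_gt0 _; exact: harmonic_mean_ge.
move: (eq_factor_upper H0 (w0 p) HD (hc u v) eqHw).
move=> /(harmonic_mean_eq_max (dg_gt0 u) (dg_gt0 v) (D_ge u) (D_ge v))/eqP.
by rewrite eqr_nat => /eqP.
Qed.

(** Both ranges of [alpha] are instances, with [cl] and [cu] taken from d^(2p) and D^(2p). The
    condition on d = D makes the two bounds coincide for a regular graph, which squeezes [GA1]. *)
Lemma GA1_bounds (cl cu : R) : 0 < cl ->
    (forall u v, cl <= (dg u * dg v) `^ p <= cu) ->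
    (d = D -> cl = cu) ->
  [/\ d * cl * randic alpha G <= GA1 R G,
      GA1 R G <= D * cu * randic alpha G,
      d * cl * randic alpha G = GA1 R G <-> regular_graph G
    & GA1 R G = D * cu * randic alpha G <-> regular_graph G].
Proof.
move=> cl0 hc cE.
have [ge eqge] : _ /\ _ := @GA1_lower cl cl0 (fun u v => proj1 (andP (hc u v))).
have [le eqle] : _ /\ _ := @GA1_upper cu (fun u v => proj2 (andP (hc u v))).
have eqreg : regular_graph G -> d * cl * randic alpha G = D * cu * randic alpha G.
  move=> /(regular_min_max hedge) dE; have dD : d = D by rewrite /d dE.
  by rewrite (cE dD) dD.
split=> //; split=> // /eqreg E; apply/le_anti.
- by rewrite ge E le.
- by rewrite le -E ge.
Qed.

Lemma GA1_bounds_le : alpha <= - (1 / 2) ->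
  [/\ d `^ (- 2 * alpha) * randic alpha G <= GA1 R G,
      GA1 R G <= D `^ (- 2 * alpha) * randic alpha G,
      d `^ (- 2 * alpha) * randic alpha G = GA1 R G <-> regular_graph G
    & GA1 R G = D `^ (- 2 * alpha) * randic alpha G <-> regular_graph G].
Proof.
move=> ha; have [A /edgesP[a _]] := set0Pn _ hedge.
have D0 : 0 < D := lt_le_trans (dg_gt0 a) (D_ge a).
have p0 : 0 <= p by rewrite /p; lra.
have pE : - 2 * alpha - 1 = 2 * p by rewrite /p; field.
(* Splitting off one factor, d^(-2 alpha) = d * d^(2p) and likewise for D, gives the shape of
   [GA1_bounds]. *)
rewrite (powRSr _ d_gt0) (powRSr _ D0) pE.
apply: GA1_bounds => [|u v|->//]; first exact: powR_gt0.
rewrite -!powR_mulrr//; apply/andP; split; apply: powR_le_nneg => //.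
- by rewrite mulr_ge0 ?ltW.
- by apply: ler_pM; rewrite ?d_le ?ltW.
- by rewrite mulr_ge0 ?ltW.
- by apply: ler_pM; rewrite ?D_ge ?ltW.
Qed.

Lemma GA1_bounds_ge : - (1 / 2) <= alpha ->
  [/\ d * D `^ (- 2 * alpha - 1) * randic alpha G <= GA1 R G,
      GA1 R G <= D * d `^ (- 2 * alpha - 1) * randic alpha G,
      d * D `^ (- 2 * alpha - 1) * randic alpha G = GA1 R G <-> regular_graph G
    & GA1 R G = D * d `^ (- 2 * alpha - 1) * randic alpha G <-> regular_graph G].
Proof.
move=> ha; have [A /edgesP[a _]] := set0Pn _ hedge.
have D0 : 0 < D := lt_le_trans (dg_gt0 a) (D_ge a).
have p0 : p <= 0 by rewrite /p; lra.
have -> : - 2 * alpha - 1 = 2 * p by rewrite /p; field.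
(* Here p <= 0 reverses the order of the powers, so [cl] is D^(2p) and [cu] is d^(2p). *)
apply: GA1_bounds => [|u v|->//]; first exact: powR_gt0.
rewrite -!powR_mulrr//; apply/andP; split; apply: powR_le_npos => //.
- by rewrite mulr_gt0.
- by apply: ler_pM; rewrite ?D_ge ?ltW.
- by rewrite mulr_gt0.
- by apply: ler_pM; rewrite ?d_le ?ltW.
Qed.

End EdgeSums.

Theorem theorem2p7 (R : realType) (G : sgraph) (alpha : R)
    (hconn : connected_graph G) (hedge : edges G != finset.set0)
    (halpha : alpha != 0) :
  let D : R := (max_degree G)%:R in
  let d : R := (min_degree G)%:R in
  (alpha <= - (1 / 2) ->
     [/\ d `^ (- 2 * alpha) * randic alpha G <= GA1 R G,
         GA1 R G <= D `^ (- 2 * alpha) * randic alpha G,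
         d `^ (- 2 * alpha) * randic alpha G = GA1 R G <-> regular_graph G
       & GA1 R G = D `^ (- 2 * alpha) * randic alpha G <-> regular_graph G])
  /\
  (- (1 / 2) <= alpha ->
     [/\ d * D `^ (- 2 * alpha - 1) * randic alpha G <= GA1 R G,
         GA1 R G <= D * d `^ (- 2 * alpha - 1) * randic alpha G,
         d * D `^ (- 2 * alpha - 1) * randic alpha G = GA1 R G
           <-> regular_graph G
       & GA1 R G = D * d `^ (- 2 * alpha - 1) * randic alpha G
           <-> regular_graph G]).
Proof.
  by split; [exact: GA1_bounds_le|exact: GA1_bounds_ge].
Qed.
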